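(* Let $f\colon K\to L$ be a simplicial map between two filtered simplicial complexes admitting a section $s\colon L\to K$. Let $X$ and $Y$ be the filtered chain complexes induced by the filtrations of $K$ and $L$, and denote again by $f\colon X\to Y$ and $s\colon Y\to X$ the induced morphisms of filtered chain complexes. Then the total boundary matrix of the filtered kernel $\ker f$, with respect to its quasi-minimal set of generators $\{\sigma-sf(\sigma)\mid \sigma\in K,\ \sigma\notin\mathrm{im}(s)\}$ (where $\sigma-sf(\sigma)$ has degree $\deg(\sigma)$ and entrance time $\mathrm{ent}(\sigma)$), is obtained from the total boundary matrix of $X$ with respect to the simplices of $K$ by removing the columns and rows corresponding to the simplices $\sigma\in K$ for which $\sigma=sf(\sigma)$.
   Context: $\mathbb{F}$ is a finite prime field. Chain complexes are non-negatively graded complexes of $\mathbb{F}$-vector spaces and are assumed compact, i.e. $\bigoplus_n C_n$ is finite dimensional (in particular the simplicial complexes are finite); $\mathbf{ch}$ is the category of these. A functor $X\colon[0,\infty)\to\mathbf{ch}$ has values $X^t$ and transition morphisms $X^{s\le t}$; $X_n^t$ is the degree $n$ part of $X^t$; $\delta$ denotes the differential. $X$ is tame if there is a finite sequence $0=\tau_0<\dots<\tau_k$ such that $X^{s\le t}$ may fail to be an isomorphism only when $s<\tau_a\le t$ for some $a\in\{1,\dots,k\}$. A filtered chain complex is a tame $X$ all of whose transition morphisms are monomorphisms. Generators: each generator $x$ has a degree $n$ and an entrance time $t$, with $x\in X_n^t$; a finite set $\mathcal G$ of such elements generates $X$ if the elements, their images under transition morphisms, and the differentials of these span every $X_n^t$.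 The radical $\mathrm{rad}X_n\subset X_n$ has value at $t$ the sum of the images of $X_n^{s<t}$ over all $s<t$. $\mathcal G$ is quasi-minimal if for all $n$ and $t$ the set of $x\in\mathcal G$ with entrance time $t$ and degree $n$ is (maps bijectively onto) a basis of $(X_n/\mathrm{rad}X_n)^t$. Then for each $n,t$ the generators of degree $n$ and entrance time $\le t$ form a basis of $X_n^t$, elements being identified with their images under the (injective) transition morphisms. The total boundary matrix of $X$ with respect to a quasi-minimal $\mathcal G=\{x_1,\dots,x_m\}$ is the $m\times m$ matrix $d=(d^i_j)$ ($i$ row, $j$ column index) with $\delta(x_j)=\sum_i d^i_jx_i$. Filtered simplicial complexes: each simplex $\sigma$ has a degree $\deg(\sigma)$ (its dimension) and an entrance time $\mathrm{ent}(\sigma)\in[0,\infty)$ given by the filtration; the filtered chain complex induced by $K$ has at $t$ the simplicial chain complex over $\mathbb{F}$ of the subcomplex of simplices with entrance time $\le t$, with inclusions as transition morphisms; the (oriented) simplices of $K$ form a quasi-minimal set of generators of it. Simplicial maps here are compatible with the filtrations: $\mathrm{ent}(\sigma)\ge\mathrm{ent}(f(\sigma))$ (and $\deg(\sigma)\ge\deg(f(\sigma))$ always). The induced morphism $f\colon X\to Y$ is the usual simplicial chain map: a simplex $\sigma$ of dimension $n$ is sent to $f(\sigma)$ (with the induced orientation) if $\dim f(\sigma)=n$ and to $0$ otherwise. A section is a simplicial map $s\colon L\to K$, compatible with the filtrations, with $f s=\mathrm{id}_L$; then $\mathrm{ent}(s(\tau))=\mathrm{ent}(\tau)$ and $\deg(s(\tau))=\deg(\tau)$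 for every $\tau\in L$. In $\sigma-sf(\sigma)$ and in $\sigma=sf(\sigma)$ the maps $s,f$ are the induced chain morphisms, and $\sigma\notin\mathrm{im}(s)$ means that the simplex $\sigma$ is not of the form $s(\tau)$ with $\tau\in L$. The filtered kernel $\ker f$ is the filtered chain complex with $(\ker f)_n^t=\ker(f_n^t\colon X_n^t\to Y_n^t)$, and transition morphisms and differentials induced by those of $X$. *)

(* Defs.v *)
From HB Require Import structures.
From mathcomp Require Import all_boot all_order all_algebra all_fingroup.
From mathcomp Require Import reals interval_inference.

Set Implicit Arguments.
Unset Strict Implicit.
Unset Printing Implicit Defensive.

Import Order.TTheory GRing.Theory Num.Theory.
Local Open Scope ring_scope.

(* Compact non-negatively graded chain complexes.  The differential of degree
   0 elements is zero, so only diff n : C_(n+1) -> C_n is recorded. *)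
Record chainComplex (F : fieldType) := ChainComplex {
  chain_space :> nat -> vectType F;
  diff : forall n, 'Hom(chain_space n.+1, chain_space n);
  diff_diff : forall n c, diff n (diff n.+1 c) = 0;
  chain_compact :
    exists N, forall n, (N <= n)%N -> dim (chain_space n) = 0%N }.

Section Filtered.
Variables (F : fieldType) (R : realType).
Implicit Types s t u : {nonneg R}.

Record chFunctor := ChFunctor {
  functor_at :> {nonneg R} -> chainComplex F;
  trans : forall s t, s <= t ->
    forall n, 'Hom(functor_at s n, functor_at t n);
  trans_diff : forall s t (st : s <= t) n x,
    trans st n (diff _ n x) = diff _ n (trans st n.+1 x);
  trans_id : forall t (tt : t <= t) n x, trans tt n x = x;
  trans_comp : forall s t u (st : s <= t) (tu : t <= u) (su : s <= u) n x,
    trans su n x = trans tu n (trans st n x) }.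

Definition tame (X : chFunctor) : Prop :=
  exists2 tau : seq {nonneg R}, path <%R 0%:nng tau &
    forall s t (st : s <= t), (forall a, a \in tau -> ~~ (s < a <= t)) ->
      forall n, bijective (trans X st n).

Record filteredChain := FilteredChain {
  filtered_functor :> chFunctor;
  filtered_tame : tame filtered_functor;
  filtered_mono : forall s t (st : s <= t) n,
    injective (trans filtered_functor st n) }.

Record chMorphism (X Y : chFunctor) := ChMorphism {
  chmor :> forall t n, 'Hom(X t n, Y t n);
  chmor_diff : forall t n x, chmor t n (diff (X t) n x)
                           = diff (Y t) n (chmor t n.+1 x);
  chmor_trans : forall s t (st : s <= t) n x,
    chmor t n (trans X st n x) = trans Y st n (chmor s n x) }.

Lemma tame_seq (X : chFunctor) (S : seq {nonneg R}) :
    (forall s t (st : s <= t), (forall a, a \in S -> ~~ (s < a <= t)) ->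
      forall n, bijective (trans X st n)) -> tame X.
Proof.
move=> h; exists (sort <=%R (undup [seq a <- S | 0%:nng < a])).
  rewrite (path_sortedE lt_trans); apply/andP; split.
    by apply/allP => a; rewrite mem_sort mem_undup mem_filter => /andP[].
  by rewrite sort_lt_sorted undup_uniq.
move=> s t st hs; apply: h => a aS; apply/negP => /andP[sa at_].
have: a \in sort <=%R (undup [seq a <- S | 0%:nng < a]).
  rewrite mem_sort mem_undup mem_filter aS andbT.
  by apply: le_lt_trans sa; rewrite -num_le /=.
by move=> /hs; rewrite sa at_.
Qed.

Section Kernel.
Variables (X Y : filteredChain) (f : chMorphism X Y).

Definition ker_space t n : vectType F := subvs_of (lker (f t n)).

(* vsproj corestricts: it is only applied to elements of the kernel. *)
Definition ker_diff t n : 'Hom(ker_space t n.+1, ker_space t n) :=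
  linfun (vsproj (lker (f t n)) \o diff (X t) n \o vsval).

Definition ker_trans s t (st : s <= t) n :
    'Hom(ker_space s n, ker_space t n) :=
  linfun (vsproj (lker (f t n)) \o trans X st n \o vsval).

Lemma ker_diffE t n x : vsval (ker_diff t n x) = diff (X t) n (vsval x).
Proof.
rewrite lfunE /= vsprojK // memv_ker chmor_diff.
by have := subvsP x; rewrite memv_ker => /eqP ->; rewrite linear0.
Qed.

Lemma ker_transE s t (st : s <= t) n x :
  vsval (ker_trans st n x) = trans X st n (vsval x).
Proof.
rewrite lfunE /= vsprojK // memv_ker chmor_trans.
by have := subvsP x; rewrite memv_ker => /eqP ->; rewrite linear0.
Qed.

Lemma ker_diff_diff t n c : ker_diff t n (ker_diff t n.+1 c) = 0.
Proof. by apply: val_inj; rewrite /= !ker_diffE diff_diff. Qed.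

Lemma ker_compact t :
  exists N, forall n, (N <= n)%N -> dim (ker_space t n) = 0%N.
Proof.
have [N hN] := chain_compact (X t); exists N => n /hN dX.
have -> : dim (ker_space t n) = \dim (lker (f t n)) by [].
by apply/eqP; rewrite -leqn0 -dX -dimvf dimvS ?subvf.
Qed.

Definition ker_at t : chainComplex F :=
  ChainComplex (@ker_diff_diff t) (ker_compact t).

Lemma ker_trans_diff s t (st : s <= t) n (x : ker_at s n.+1) :
  ker_trans st n (diff (ker_at s) n x) = diff (ker_at t) n (ker_trans st n.+1 x).
Proof.
by apply: val_inj; rewrite /= ker_transE !ker_diffE ker_transE trans_diff.
Qed.

Lemma ker_trans_id t (tt : t <= t) n (x : ker_at t n) : ker_trans tt n x = x.
Proof. by apply: val_inj; rewrite /= ker_transE trans_id. Qed.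

Lemma ker_trans_comp s t u (st : s <= t) (tu : t <= u) (su : s <= u) n
    (x : ker_at s n) : ker_trans su n x = ker_trans tu n (ker_trans st n x).
Proof. by apply: val_inj; rewrite /= !ker_transE (trans_comp st tu). Qed.

Definition ker_functor : chFunctor :=
  ChFunctor ker_trans_diff ker_trans_id ker_trans_comp.

Lemma ker_mono s t (st : s <= t) n : injective (trans ker_functor st n).
Proof.
move=> x y /(congr1 vsval); rewrite /= !ker_transE => /filtered_mono h.
exact: val_inj.
Qed.

Lemma ker_tame : tame ker_functor.
Proof.
have [tX _ hX] := filtered_tame X; have [tY _ hY] := filtered_tame Y.
apply: (@tame_seq _ (tX ++ tY)) => s t st h n.
have /hX-/(_ st n)[g gK Kg] : (forall a, a \in tX -> ~~ (s < a <= t)).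
  by move=> a aX; apply: h; rewrite mem_cat aX.
suff k_in z : g (vsval (z : ker_space t n)) \in lker (f s n).
  exists (fun z => Subvs (k_in z)) => z; apply: val_inj => /=.
    by rewrite ker_transE gK.
  by rewrite ker_transE /= Kg.
rewrite memv_ker; apply/eqP; apply: (@filtered_mono Y _ _ st n).
rewrite -chmor_trans Kg linear0.
by have := subvsP z; rewrite memv_ker => /eqP.
Qed.

Definition filtered_ker : filteredChain := FilteredChain ker_tame ker_mono.

End Kernel.

Section Generators.
Variable X : chFunctor.

Record generator := Generator {
  gdeg : nat;
  gent : {nonneg R};
  gval : X gent gdeg }.

(* The degree n component at t of the generator x, for t at least its entrance
   time; it is 0 if n is not the degree of x or if x has not entered at t. *)
Definition gimage (x : generator) t n : X t n :=
  match gdeg x =P n, @idP (gent x <= t) with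
  | ReflectT e, ReflectT xt => ecast k (X t k) e (trans X xt _ (gval x))
  | _, _ => 0
  end.

(* The value of rad X_n at t: finite sums of elements of the images of the
   transition morphisms from s < t. *)
Definition in_radical t n (v : X t n) : Prop :=
  exists k (s : 'I_k -> {nonneg R}) (st : forall i, s i < t)
    (u : forall i, X (s i) n), v = \sum_(i < k) trans X (ltW (st i)) n (u i).

Variables (m : nat) (x : 'I_m -> generator).

Definition generates : Prop := forall t n,
  (<< [seq gimage (x i) t n | i <- enum 'I_m] ++
      [seq diff (X t) n (gimage (x i) t n.+1) | i <- enum 'I_m] >> = fullv)%VS.

(* The generators of degree n and entrance time t form a basis of the quotient
   of X_n^t by the radical: they are independent and spanning modulo it. *)
Definition basis_mod_radical t n : Prop :=
  let comb (c : 'I_m -> F) : X t n :=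
    \sum_(i < m | (gdeg (x i) == n) && (gent (x i) == t))
      c i *: gimage (x i) t n in
  (forall c, in_radical (comb c) ->
     forall i, gdeg (x i) = n -> gent (x i) = t -> c i = 0) /\
  (forall v, exists c, in_radical (v - comb c)).

Definition quasi_minimal_generators : Prop :=
  generates /\ forall t n, basis_mod_radical t n.

(* The equations delta(x_j) = sum_i d^i_j x_i in the direct sum of the X_n^t,
   where t is any time at which all the generators have entered, and where the
   generators are identified with their images at t.  They are written degree
   by degree; as gimage vanishes off the degree of the generator, this forces
   d i j to be 0 unless deg x_j = deg x_i + 1 when x is quasi-minimal. *)
Definition is_total_boundary_matrix (d : 'M[F]_m) : Prop :=
  forall t, (forall i, gent (x i) <= t) -> forall j n,
    diff (X t) n (gimage (x j) t n.+1) = \sum_(i < m) d i j *: gimage (x i) t n.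

End Generators.
End Filtered.
Arguments Generator {F R X} gdeg gent gval.

Section Simplicial.
Variable R : realType.
Implicit Types s t u : {nonneg R}.

(* Every element of V is a vertex; entrance is meaningful on faces only. *)
Record filteredComplex (V : finType) := FilteredComplex {
  faces : {set {set V}};
  entrance : {set V} -> {nonneg R};
  face_neq0 : set0 \notin faces;
  face_vertex : forall v, [set v] \in faces;
  face_sub : forall S T : {set V},
    S \in faces -> T \subset S -> T != set0 -> T \in faces;
  entrance_sub : forall S T : {set V}, S \in faces -> T \in faces ->
    T \subset S -> entrance T <= entrance S }.

Record simplicialMap V W (K : filteredComplex V) (L : filteredComplex W) :=
  SimplicialMap {
    vertex_map :> V -> W;
    map_face : forall S, S \in faces K -> vertex_map @: S \in faces L;
    map_entrance : forall S, S \in faces K ->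
      entrance L (vertex_map @: S) <= entrance K S }.

(* A choice of an ordering of the vertices of each simplex. *)
Record orientation (V : finType) := Orientation {
  orient :> {set V} -> seq V;
  orientP : forall S, perm_eq (orient S) (enum S) }.

Definition simplex V (K : filteredComplex V) := {S : {set V} | S \in faces K}.
HB.instance Definition _ V (K : filteredComplex V) := Finite.on (simplex K).

Definition sdim V (K : filteredComplex V) (S : simplex K) := #|val S|.-1.
Definition sent V (K : filteredComplex V) (S : simplex K) : {nonneg R} :=
  entrance K (val S).

Definition is_simplex_at V (K : filteredComplex V) t n (S : {set V}) :=
  [&& S \in faces K, #|S| == n.+1 & entrance K S <= t].
Definition simplex_at V (K : filteredComplex V) t n :=
  {S : {set V} | is_simplex_at K t n S}.
HB.instance Definition _ V (K : filteredComplex V) t n :=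
  Finite.on (simplex_at K t n).

Definition SimplexAt V (K : filteredComplex V) t n (S : {set V})
  (h : is_simplex_at K t n S) : simplex_at K t n := exist _ S h.

Section Chains.
Variable F : fieldType.

Definition free_gen (I : finType) (i : I) : {ffun I -> F^o} :=
  [ffun j => (j == i)%:R].

Definition free_fun (I : finType) (U : vectType F) (b : I -> U)
  (c : {ffun I -> F^o}) : U := \sum_i (c i : F) *: b i.

Lemma free_fun_linear (I : finType) (U : vectType F) (b : I -> U) :
  linear (free_fun b).
Proof.
move=> a c c'; rewrite /free_fun scaler_sumr -big_split /=.
by apply: eq_bigr => i _; rewrite !ffunE scalerDl scalerA.
Qed.
HB.instance Definition _ (I : finType) (U : vectType F) (b : I -> U) :=
  GRing.isLinear.Build F {ffun I -> F^o} U _ (free_fun b) (free_fun_linear b).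

Definition free_hom (I : finType) (U : vectType F) (b : I -> U) :
  'Hom({ffun I -> F^o}, U) := linfun (free_fun b).

Lemma free_homE (I : finType) (U : vectType F) (b : I -> U) c :
  free_hom b c = \sum_i (c i : F) *: b i.
Proof. by rewrite lfunE. Qed.

Lemma free_hom_gen (I : finType) (U : vectType F) (b : I -> U) i :
  free_hom b (free_gen i) = b i.
Proof.
rewrite free_homE (bigD1 i) //= big1 => [|j ji].
  by rewrite ffunE eqxx addr0 scale1r.
by rewrite ffunE (negPf ji) scale0r.
Qed.

Lemma free_gen_sum (I : finType) (c : {ffun I -> F^o}) :
  c = \sum_i (c i : F) *: free_gen i.
Proof.
apply/ffunP => j; rewrite sum_ffunE (bigD1 j) //= big1 => [|i ij].
  by rewrite !ffunE eqxx addr0 [_ *: _]mulr1.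
by rewrite !ffunE eq_sym (negPf ij) [_ *: _]mulr0.
Qed.

Lemma free_homP (I : finType) (U : vectType F) (g h : 'Hom({ffun I -> F^o}, U)) :
  (forall i, g (free_gen i) = h (free_gen i)) -> g = h.
Proof.
move=> gh; apply/lfunP => c; rewrite [c]free_gen_sum !linear_sum /=.
by apply: eq_bigr => i _; rewrite !linearZ /= gh.
Qed.

(* The sign of w relative to u: that of the permutation taking u to w, and 0
   if w is not a reordering of u. *)
Definition rel_sign (V : finType) n (w u : n.-tuple V) : F :=
  if [pick p : 'S_n | [tuple tnth u (p i) | i < n] == w] is Some p
  then (-1) ^+ p else 0.

Lemma rel_sign_det (V : finType) n (w u : n.-tuple V) : uniq u ->
  rel_sign w u = \det (\matrix_(i, j) (tnth w i == tnth u j)%:R).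
Proof.
move=> /tuple_uniqP uu.
have prodE (p : 'S_n) : \prod_i (\matrix_(i, j) (tnth w i == tnth u j)%:R : 'M[F]_n) i (p i)
    = ([tuple tnth u (p i) | i < n] == w)%:R.
  case: eqP => [<-|ne].
    by rewrite big1 // => i _; rewrite mxE tnth_mktuple eqxx.
  have /forallPn[i /negPf hi] : ~~ [forall i, tnth w i == tnth u (p i)].
    apply/negP => /forallP h; apply: ne; apply: eq_from_tnth => i.
    by rewrite tnth_mktuple (eqP (h i)).
  by rewrite (bigD1 i) //= mxE hi mul0r.
rewrite /rel_sign /determinant; case: pickP => [p /eqP pw|np].
  rewrite (bigD1 p) //= prodE pw eqxx mulr1 big1 ?addr0 // => q qp.
  rewrite prodE; case: eqP => [qw|]; last by rewrite mulr0.
  case/eqP: qp; apply/permP => i; apply: uu.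
  by have := congr1 (fun z : n.-tuple V => tnth z i) (etrans qw (esym pw)); rewrite !tnth_mktuple.
by rewrite big1 // => q _; rewrite prodE np mulr0.
Qed.

Definition tdel (V : finType) n (i : 'I_n.+1) (w : n.+1.-tuple V) : n.-tuple V :=
  [tuple tnth w (lift i j) | j < n].

Definition tuple_perm (V : finType) n (p : 'S_n) (w : n.-tuple V) : n.-tuple V :=
  [tuple tnth w (p i) | i < n].

Lemma rel_sign_perm (V : finType) n (p : 'S_n) (w u : n.-tuple V) : uniq u ->
  rel_sign (tuple_perm p w) u = (-1) ^+ p * rel_sign w u.
Proof.
move=> uu; rewrite !rel_sign_det // -[(-1) ^+ p]det_perm -det_mulmx.
congr (\det _); rewrite -row_permE; apply/matrixP => i j.
by rewrite !mxE tnth_mktuple.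
Qed.

Lemma rel_sign_nonuniq (V : finType) n (w u : n.-tuple V) : uniq u ->
  ~~ uniq w -> rel_sign w u = 0.
Proof.
move=> uu; rewrite /rel_sign; case: pickP => // p /eqP <- /negP[].
move/tuple_uniqP: uu => uu; apply/tuple_uniqP => i j.
by rewrite !tnth_mktuple => /uu /perm_inj.
Qed.

(* del_sign w u is the coefficient of u in the alternating sum of the faces
   of w. *)
Definition del_sign (V : finType) n (w : n.+1.-tuple V) (u : n.-tuple V) : F :=
  \sum_(i < n.+1) (-1) ^+ i * rel_sign (tdel i w) u.

Definition del_mx (V : finType) n (w : n.+1.-tuple V) (u : n.-tuple V) : 'M[F]_n.+1 :=
  \matrix_(i, j) if unlift ord0 j is Some k
    then (tnth w i == tnth u k)%:R else 1.

Lemma del_sign_det (V : finType) n (w : n.+1.-tuple V) (u : n.-tuple V) : uniq u ->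
  del_sign w u = \det (del_mx w u).
Proof.
move=> uu; rewrite (expand_det_col _ ord0); apply: eq_bigr => i _.
rewrite rel_sign_det // mxE unlift_none mul1r /cofactor addn0; congr (_ * _).
by congr (\det _); apply/matrixP => k j; rewrite !mxE liftK tnth_mktuple.
Qed.

Lemma del_sign_perm (V : finType) n (p : 'S_n.+1) (w : n.+1.-tuple V)
    (u : n.-tuple V) : uniq u ->
  del_sign (tuple_perm p w) u = (-1) ^+ p * del_sign w u.
Proof.
move=> uu; rewrite !del_sign_det // -[(-1) ^+ p]det_perm -det_mulmx.
congr (\det _); rewrite -row_permE; apply/matrixP => i j.
by rewrite !mxE tnth_mktuple.
Qed.

Lemma del_sign_nonuniq (V : finType) n (w : n.+1.-tuple V) (u : n.-tuple V) :
  uniq u -> ~~ uniq w -> del_sign w u = 0.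
Proof.
move=> uu /tuple_uniqP nw; rewrite del_sign_det //.
have [i [j [ij wij]]] : exists i j, i != j /\ tnth w i = tnth w j.
  have /injectivePn[i [j ij wij]] : ~~ injectiveb (tnth w).
    by apply/injectiveP.
  by exists i, j.
apply: (determinant_alternate ij) => k; rewrite !mxE.
by case: unlift => // l; rewrite wij.
Qed.

Lemma del_del_sign (V : finType) n (w : n.+2.-tuple V) (u : n.-tuple V) : uniq u ->
  \sum_(i < n.+2) (-1) ^+ i * del_sign (tdel i w) u = 0.
Proof.
move=> uu; pose M : 'M[F]_n.+2 := \matrix_(i, j)
  if unlift ord0 j is Some k then
    if unlift ord0 k is Some l then (tnth w i == tnth u l)%:R else 1 else 1.
transitivity (\det M).
  rewrite (expand_det_col _ ord0); apply: eq_bigr => i _.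
  rewrite del_sign_det // mxE unlift_none mul1r /cofactor addn0; congr (_ * _).
  congr (\det _); apply/matrixP => k j; rewrite !mxE liftK.
  by case: unlift => // l; rewrite tnth_mktuple.
rewrite -det_tr; apply: (@determinant_alternate _ _ _ ord0 (lift ord0 ord0)) => //.
by move=> k; rewrite !mxE unlift_none liftK unlift_none.
Qed.

Section Complex.
Variables (V : finType) (K : filteredComplex V) (o : orientation V).

Definition chains_space t n : vectType F := {ffun simplex_at K t n -> F^o}.

Lemma orient_size t n (S : simplex_at K t n) : size (o (val S)) == n.+1.
Proof.
by rewrite (perm_size (orientP o _)) -cardE; case/and3P: (valP S).
Qed.
Definition orient_tuple t n (S : simplex_at K t n) : n.+1.-tuple V :=
  Tuple (orient_size S).

(* The oriented simplex [w_0, ..., w_n] as a chain; it is 0 if the w_i are not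
   the distinct vertices of a simplex which has entered at t. *)
Definition oriented_chain t n (w : n.+1.-tuple V) : chains_space t n :=
  [ffun S => rel_sign w (orient_tuple S)].

Definition chains_diff t n : 'Hom(chains_space t n.+1, chains_space t n) :=
  free_hom (fun S => \sum_(i < n.+2)
    (-1) ^+ i *: oriented_chain t (tdel i (orient_tuple S))).

Lemma simplex_at_le s t (st : s <= t) n (S : simplex_at K s n) :
  is_simplex_at K t n (val S).
Proof. by case/and3P: (valP S) => *; apply/and3P; split=> //; exact: le_trans st. Qed.

Definition chains_trans s t (st : s <= t) n :
    'Hom(chains_space s n, chains_space t n) :=
  free_hom (fun S => free_gen (SimplexAt (simplex_at_le st S))).

Lemma orient_uniq t n (S : simplex_at K t n) : uniq (orient_tuple S).
Proof. by rewrite (perm_uniq (orientP o _)) enum_uniq. Qed.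

Lemma orient_set t n (S : simplex_at K t n) : [set v in orient_tuple S] = val S.
Proof.
by apply/setP => v; rewrite inE (perm_mem (orientP o _)) mem_enum.
Qed.

Lemma oriented_chain_perm t n (p : 'S_n.+1) (w : n.+1.-tuple V) :
  oriented_chain t (tuple_perm p w) = (-1) ^+ p *: oriented_chain t w.
Proof.
by apply/ffunP => S; rewrite !ffunE rel_sign_perm ?orient_uniq.
Qed.

Lemma oriented_chain_nonuniq t n (w : n.+1.-tuple V) : ~~ uniq w ->
  oriented_chain t w = 0.
Proof.
by move=> nw; apply/ffunP => S; rewrite !ffunE rel_sign_nonuniq ?orient_uniq.
Qed.

Lemma rel_sign_neq0 n (w u : n.-tuple V) :
  rel_sign w u != 0 -> w =i u.
Proof.
rewrite /rel_sign; case: pickP => [p /eqP <- _ v|]; last by rewrite eqxx.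
apply/tnthP/tnthP => -[i ->].
  by exists (p i); rewrite tnth_mktuple.
by exists (p^-1 i)%g; rewrite tnth_mktuple permKV.
Qed.

Lemma rel_sign_refl n (u : n.-tuple V) : uniq u -> rel_sign u u = 1.
Proof.
move=> uu; rewrite rel_sign_det //; rewrite -[RHS](det1 F n); congr (\det _).
apply/matrixP => i j; rewrite !mxE; have [->|ij] := eqVneq i j; first by rewrite eqxx.
by move/tuple_uniqP: uu => /inj_eq ->; rewrite (negPf ij).
Qed.

Lemma oriented_chain_orient t n (S : simplex_at K t n) :
  oriented_chain t (orient_tuple S) = free_gen S.
Proof.
apply/ffunP => T; rewrite !ffunE; case: eqP => [->|TS].
  by rewrite rel_sign_refl ?orient_uniq.
apply/eqP; apply/negPn/negP => /rel_sign_neq0 h; apply: TS; apply: val_inj.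
by rewrite -!orient_set; apply/setP => v; rewrite !inE h.
Qed.

Lemma perm_tact n (w u : n.-tuple V) : perm_eq w u ->
  exists p : 'S_n, w = tuple_perm p u.
Proof.
move/tuple_permP => [p e]; exists p; apply: val_inj => /=; rewrite e.
by [].
Qed.

Variant oriented_spec t n (w : n.+1.-tuple V) : Prop :=
| OrientedDegenerate of ~~ uniq w
| OrientedSimplex S p of w = tuple_perm p (@orient_tuple t n S).

Lemma orientedP t n (w : n.+1.-tuple V) :
  [set v in w] \in faces K -> entrance K [set v in w] <= t -> oriented_spec t w.
Proof.
move=> wK wt; case uw: (uniq w); last by left; rewrite uw.
have wS : is_simplex_at K t n [set v in w].
  rewrite /is_simplex_at wK wt andbT /= cardsE.
  by rewrite (card_uniqP uw) size_tuple.
have /perm_tact[p pw] : perm_eq w (orient_tuple (SimplexAt wS)).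
  apply: uniq_perm => // [|v]; first exact: orient_uniq.
  by rewrite /= (perm_mem (orientP o _)) mem_enum inE.
exact: OrientedSimplex pw.
Qed.

Lemma chains_diff_oriented t n (w : n.+2.-tuple V) :
    [set v in w] \in faces K -> entrance K [set v in w] <= t ->
  chains_diff t n (oriented_chain t w) =
    \sum_(i < n.+2) (-1) ^+ i *: oriented_chain t (tdel i w).
Proof.
have coef (u : n.+2.-tuple V) (T : simplex_at K t n) :
    (\sum_(i < n.+2) (-1) ^+ i *: oriented_chain t (tdel i u)) T =
    del_sign u (orient_tuple T).
  by rewrite sum_ffunE; apply: eq_bigr => i _; rewrite !ffunE.
move=> wK wt; have [nw|S p wE] := orientedP wK wt.
  rewrite oriented_chain_nonuniq // linear0; apply/ffunP => T.
  by rewrite coef ffunE del_sign_nonuniq ?orient_uniq.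
rewrite wE oriented_chain_perm linearZ /= oriented_chain_orient free_hom_gen.
apply/ffunP => T; rewrite ffunE coef.
by rewrite coef del_sign_perm ?orient_uniq.
Qed.

Lemma tdel_sub n (i : 'I_n.+1) (w : n.+1.-tuple V) :
  [set v in tdel i w] \subset [set v in w].
Proof.
apply/subsetP => v; rewrite !inE => /tnthP[j ->].
by rewrite tnth_mktuple mem_tnth.
Qed.

Lemma tdel_face n (i : 'I_n.+2) (w : n.+2.-tuple V) t :
    [set v in w] \in faces K -> entrance K [set v in w] <= t ->
  [set v in tdel i w] \in faces K /\ entrance K [set v in tdel i w] <= t.
Proof.
move=> wK wt; have wiK : [set v in tdel i w] \in faces K.
  apply: face_sub wK (tdel_sub i w) _; apply/set0Pn.
  by exists (tnth (tdel i w) ord0); rewrite inE mem_tnth.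
split=> //; apply: le_trans wt; exact: entrance_sub (tdel_sub i w).
Qed.

Lemma orient_face t n (S : simplex_at K t n) :
  [set v in orient_tuple S] \in faces K /\
  entrance K [set v in orient_tuple S] <= t.
Proof. by rewrite orient_set; case/and3P: (valP S). Qed.

Lemma chains_diff_diff t n c : chains_diff t n (chains_diff t n.+1 c) = 0.
Proof.
suff: (chains_diff t n \o chains_diff t n.+1)%VF = 0.
  by move=> /lfunP/(_ c); rewrite comp_lfunE zero_lfunE.
apply: free_homP => S; rewrite comp_lfunE zero_lfunE free_hom_gen linear_sum /=.
have [SK St] := orient_face S.
transitivity (\sum_(i < n.+3) (-1) ^+ i *: \sum_(j < n.+2) (-1) ^+ j *:
    oriented_chain t (tdel j (tdel i (orient_tuple S)))).
  apply: eq_bigr => i _; rewrite linearZ /=; have [iK it] := tdel_face i SK St.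
  by rewrite chains_diff_oriented.
apply/ffunP => T; rewrite ffunE sum_ffunE.
rewrite -[RHS](del_del_sign (orient_tuple S) (orient_uniq T)).
apply: eq_bigr => i _; rewrite ffunE sum_ffunE; congr (_ * _).
by apply: eq_bigr => j _; rewrite !ffunE.
Qed.

Lemma chains_compact t :
  exists N, forall n, (N <= n)%N -> dim (chains_space t n) = 0%N.
Proof.
exists #|V| => n Vn.
have -> : dim (chains_space t n) = (#|{: simplex_at K t n}| * 1)%N by [].
rewrite muln1; apply: eq_card0 => S; exfalso; move: (valP S).
by case/and3P => _ /eqP SE _; have := max_card (mem (val S)); rewrite SE ltnNge Vn.
Qed.

Definition chains_at t : chainComplex F :=
  ChainComplex (@chains_diff_diff t) (chains_compact t).

Lemma chains_trans_oriented s t (st : s <= t) n (w : n.+1.-tuple V) :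
    [set v in w] \in faces K -> entrance K [set v in w] <= s ->
  chains_trans st n (oriented_chain s w) = oriented_chain t w.
Proof.
move=> wK ws; have [nw|S p wE] := orientedP wK ws.
  by rewrite !oriented_chain_nonuniq // linear0.
rewrite wE !oriented_chain_perm linearZ /= oriented_chain_orient free_hom_gen.
by rewrite -oriented_chain_orient; congr (_ *: oriented_chain t _); apply: val_inj.
Qed.

Lemma chains_trans_diff s t (st : s <= t) n (x : chains_at s n.+1) :
  chains_trans st n (diff (chains_at s) n x) =
  diff (chains_at t) n (chains_trans st n.+1 x).
Proof.
suff: (chains_trans st n \o chains_diff s n)%VF =
      (chains_diff t n \o chains_trans st n.+1)%VF.
  by move=> /lfunP/(_ x); rewrite !comp_lfunE.
apply: free_homP => S; have [SK Ss] := orient_face S.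
rewrite !comp_lfunE -oriented_chain_orient chains_trans_oriented //.
rewrite !chains_diff_oriented ?(le_trans Ss) // linear_sum.
apply: eq_bigr => i _; rewrite linearZ /=; have [iK is_] := tdel_face i SK Ss.
by rewrite chains_trans_oriented.
Qed.

Lemma chains_trans_id t (tt : t <= t) n (x : chains_at t n) :
  chains_trans tt n x = x.
Proof.
suff: chains_trans tt n = \1%VF by move=> /lfunP/(_ x); rewrite id_lfunE.
apply: free_homP => S; rewrite free_hom_gen id_lfunE.
by congr free_gen; apply: val_inj.
Qed.

Lemma chains_trans_comp s t u (st : s <= t) (tu : t <= u) (su : s <= u) n
    (x : chains_at s n) :
  chains_trans su n x = chains_trans tu n (chains_trans st n x).
Proof.
suff: chains_trans su n = (chains_trans tu n \o chains_trans st n)%VF.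
  by move=> /lfunP/(_ x); rewrite comp_lfunE.
apply: free_homP => S; rewrite comp_lfunE !free_hom_gen.
by congr free_gen; apply: val_inj.
Qed.

Definition chains_functor : chFunctor F R :=
  ChFunctor chains_trans_diff chains_trans_id chains_trans_comp.

Lemma chains_transE s t (st : s <= t) n (c : chains_space s n) S T :
  val S = val T -> chains_trans st n c S = c T.
Proof.
move=> ST; rewrite free_homE sum_ffunE (bigD1 T) //= big1 => [|U UT].
  by rewrite !ffunE -val_eqE /= ST eqxx addr0 [_ *: _]mulr1.
rewrite !ffunE -val_eqE /= ST val_eqE eq_sym (negPf UT).
by rewrite [_ *: _]mulr0.
Qed.

Lemma chains_mono s t (st : s <= t) n : injective (trans chains_functor st n).
Proof.
move=> c c' cc'; apply/ffunP => S.
have := congr1 (fun d : chains_space t n => d (SimplexAt (simplex_at_le st S))) cc'.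
by rewrite /= !(@chains_transE _ _ _ _ _ _ S).
Qed.

Lemma chains_tame : tame chains_functor.
Proof.
apply: (@tame_seq _ _ _ [seq entrance K A | A <- enum (faces K)]) => s t st h n.
have at_s (S : simplex_at K t n) : is_simplex_at K s n (val S).
  case/and3P: (valP S) => SK Sn St; rewrite /is_simplex_at SK Sn /= leNgt.
  apply/negP => sS; have /h : entrance K (val S) \in
      [seq entrance K A | A <- enum (faces K)] by rewrite map_f ?mem_enum.
  by rewrite sS St.
exists (fun c : chains_space t n => [ffun S : simplex_at K s n =>
    c (SimplexAt (simplex_at_le st S))] : chains_space s n) => c.
  by apply/ffunP => S; rewrite ffunE (@chains_transE _ _ _ _ _ _ S).
apply/ffunP => S; rewrite (@chains_transE _ _ _ _ _ _ (SimplexAt (at_s S))) //.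
by rewrite ffunE; congr (c _); apply: val_inj.
Qed.

Definition chains : filteredChain F R := FilteredChain chains_tame chains_mono.

Lemma simplex_at_sent (S : simplex K) : is_simplex_at K (sent S) (sdim S) (val S).
Proof.
rewrite /is_simplex_at lexx andbT (valP S) /= /sdim.
have : val S != set0.
  by apply: contraTneq (valP S) => ->; rewrite face_neq0.
by rewrite -card_gt0; case: #|_|.
Qed.

Definition simplex_chain (S : simplex K) : chains (sent S) (sdim S) :=
  free_gen (SimplexAt (simplex_at_sent S)).

Definition simplex_generator (S : simplex K) : generator chains :=
  Generator (sdim S) (sent S) (simplex_chain S).

End Complex.

Section Induced.
Variables (V W : finType) (K : filteredComplex V) (L : filteredComplex W).
Variables (oK : orientation V) (oL : orientation W) (f : simplicialMap K L).

Definition induced_hom t n : 'Hom(chains K oK t n, chains L oL t n) :=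
  free_hom (fun S : simplex_at K t n =>
    oriented_chain L oL t (map_tuple f (orient_tuple oK S))).

Lemma map_set n (w : n.-tuple V) : [set v in map_tuple f w] = f @: [set v in w].
Proof.
apply/setP => v; rewrite inE; apply/mapP/imsetP => -[u uw ->].
  by exists u; rewrite ?inE.
by exists u => //; move: uw; rewrite inE.
Qed.

Lemma map_orient_face t n (w : n.-tuple V) :
    [set v in w] \in faces K -> entrance K [set v in w] <= t ->
  [set v in map_tuple f w] \in faces L /\
  entrance L [set v in map_tuple f w] <= t.
Proof.
move=> wK wt; rewrite map_set; split; first exact: map_face.
exact: le_trans (map_entrance f wK) wt.
Qed.

Lemma induced_oriented t n (w : n.+1.-tuple V) :
    [set v in w] \in faces K -> entrance K [set v in w] <= t ->
  induced_hom t n (oriented_chain K oK t w) =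
    oriented_chain L oL t (map_tuple f w).
Proof.
move=> wK wt; have [nw|S p wE] := orientedP oK wK wt.
  rewrite !oriented_chain_nonuniq ?linear0 //.
  by apply: contraNN nw => /map_uniq.
rewrite wE oriented_chain_perm linearZ /= oriented_chain_orient free_hom_gen.
rewrite -oriented_chain_perm; congr oriented_chain; apply: eq_from_tnth => i.
by rewrite tnth_mktuple !tnth_map tnth_ord_tuple.
Qed.

Lemma induced_diff t n (x : chains K oK t n.+1) :
  induced_hom t n (diff (chains K oK t) n x) =
  diff (chains L oL t) n (induced_hom t n.+1 x).
Proof.
suff: (induced_hom t n \o chains_diff K oK t n)%VF =
      (chains_diff L oL t n \o induced_hom t n.+1)%VF.
  by move=> /lfunP/(_ x); rewrite !comp_lfunE.
apply: free_homP => S; have [SK St] := orient_face oK S.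
have [fK ft] := map_orient_face SK St.
rewrite !comp_lfunE -(oriented_chain_orient oK) induced_oriented //.
rewrite !chains_diff_oriented // linear_sum.
apply: eq_bigr => i _; rewrite linearZ /=; have [iK it] := tdel_face i SK St.
rewrite induced_oriented //; congr (_ *: oriented_chain _ _ _ _).
by apply: eq_from_tnth => j; rewrite !(tnth_map, tnth_ord_tuple).
Qed.

Lemma induced_trans s t (st : s <= t) n (x : chains K oK s n) :
  induced_hom t n (trans (chains K oK) st n x) =
  trans (chains L oL) st n (induced_hom s n x).
Proof.
suff: (induced_hom t n \o chains_trans K st n)%VF =
      (chains_trans L st n \o induced_hom s n)%VF.
  by move=> /lfunP/(_ x); rewrite !comp_lfunE.
apply: free_homP => S; have [SK Ss] := orient_face oK S.
have [fK fs] := map_orient_face SK Ss.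
rewrite !comp_lfunE -(oriented_chain_orient oK) chains_trans_oriented //.
rewrite !induced_oriented ?(le_trans Ss) //.
by rewrite chains_trans_oriented.
Qed.

Definition induced : chMorphism (chains K oK) (chains L oL) :=
  ChMorphism induced_diff induced_trans.

End Induced.

Section KernelGenerators.
Variables (V W : finType) (K : filteredComplex V) (L : filteredComplex W).
Variables (oK : orientation V) (oL : orientation W).
Variables (f : simplicialMap K L) (s : simplicialMap L K).

Let fC := induced oK oL f.
Let sC := induced oL oK s.

(* S is the image of a simplex under s. *)
Definition in_image (S : simplex K) : bool :=
  [exists T : simplex L, s @: val T == val S].

(* The chain s (f S), for the induced morphisms s and f. *)
Definition retract_chain (S : simplex K) : chains K oK (sent S) (sdim S) :=
  sC _ _ (fC _ _ (simplex_chain oK S)).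

Hypothesis sK : cancel s f.

Lemma induced_section t n (y : chains L oL t n) : fC t n (sC t n y) = y.
Proof.
suff: (fC t n \o sC t n)%VF = \1%VF.
  by move=> /lfunP/(_ y); rewrite comp_lfunE id_lfunE.
apply: free_homP => T; have [TL Tt] := orient_face oL T.
have [sTK sTt] := map_orient_face s TL Tt.
rewrite comp_lfunE id_lfunE -(oriented_chain_orient oL) /= !induced_oriented //.
by congr oriented_chain; apply: eq_from_tnth => j; rewrite !tnth_map sK.
Qed.

Lemma kernel_chain_in (S : simplex K) :
  simplex_chain oK S - retract_chain S \in lker (fC (sent S) (sdim S)).
Proof.
by rewrite memv_ker linearB /= [X in _ - X]induced_section subrr.
Qed.

Definition kernel_chain (S : simplex K) :
  filtered_ker fC (sent S) (sdim S) := Subvs (kernel_chain_in S).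

Definition kernel_generator (S : simplex K) : generator (filtered_ker fC) :=
  Generator (sdim S) (sent S) (kernel_chain S).

End KernelGenerators.
End Chains.
End Simplicial.

(* Main.v *)
(* The endomorphism P = 1 - s f of X commutes with the differential, is the
   identity on ker f, and kills the simplices in the image of s.  If S is not in
   that image, then S has coefficient 1 in P S and coefficient 0 in P S' for
   every other simplex S', because s f S' is zero or a simplex of im s up to
   sign.  Hence the P S form a basis of ker f at every time and degree, and
   applying P to delta S = sum_i d_i S_i gives
   delta (P S) = sum_i d_i P S_i, the sum over the S_i outside im s. *)
Require Import Defs.
From HB Require Import structures.
From mathcomp Require Import all_boot all_order all_algebra.
From mathcomp Require Import reals interval_inference.

Set Implicit Arguments.
Unset Strict Implicit.
Unset Printing Implicit Defensive.

Import Order.TTheory GRing.Theory Num.Theory.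
Local Open Scope ring_scope.

(** * Bases at every time and degree: quasi-minimality, and existence and uniqueness of the total
    boundary matrix *)

Section PointwiseBasis.
Variables (F : fieldType) (R : realType) (X : chFunctor F R).
Implicit Types (t u : {nonneg R}) (g : generator X).

Lemma gimageE g t (gt : gent g <= t) :
  gimage g t (gdeg g) = trans X gt (gdeg g) (gval g).
Proof.
rewrite /gimage; case: eqP => // e; rewrite (eq_axiomK e) /=.
move: (@idP (gent g <= t)) => q; destruct q as [gt'|] => //.
by rewrite (bool_irrelevance gt' gt).
Qed.

Lemma gimage_eq0 g t n : ~~ ((gdeg g == n) && (gent g <= t)) -> gimage g t n = 0.
Proof.
rewrite /gimage; case: eqP => // e.
move: (@idP (gent g <= t)) => q; by destruct q.
Qed.

Lemma gimage_trans g t u (tu : t <= u) n : gent g <= t ->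
  trans X tu n (gimage g t n) = gimage g u n.
Proof.
move=> gt; have [<-|ne] := eqVneq (gdeg g) n.
  have gu := le_trans gt tu.
  by rewrite (gimageE gt) (gimageE gu) -trans_comp.
by rewrite !gimage_eq0 ?(negPf ne) ?linear0.
Qed.

Variables (m : nat) (x : 'I_m -> generator X).

(** The sums run over all generators, since [gimage] vanishes off the degree and before the entrance
    time; this is why independence constrains only the coefficients of generators of degree [n]
    present at [t]. *)
Definition pointwise_basis : Prop := forall t n,
  (forall v, exists c : 'I_m -> F, v = \sum_i c i *: gimage (x i) t n) /\
  (forall c : 'I_m -> F, \sum_i c i *: gimage (x i) t n = 0 ->
     forall i, gdeg (x i) = n -> gent (x i) <= t -> c i = 0).

Hypothesis bx : pointwise_basis.

Lemma pointwise_basis_generates : generates x.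
Proof.
move=> t n; apply/eqP; rewrite eqEsubv subvf /=; apply/subvP => v _.
have [c ->] := (bx t n).1 v.
apply: memv_suml => i _; apply/memvZ/memv_span.
by rewrite mem_cat map_f ?mem_enum.
Qed.

Lemma in_radicalP t n (v : X t n) : in_radical v <->
  exists c : 'I_m -> F, v = \sum_(i | gent (x i) < t) c i *: gimage (x i) t n.
Proof.
split=> [[k [s [st [u ->]]]]|[c ->]].
  elim/big_ind: _ => [|_ _ [a ->] [b ->]|j _].
  - by exists (fun=> 0); rewrite big1 // => i _; rewrite scale0r.
  - exists (fun i => a i + b i); rewrite -big_split /=.
    by apply: eq_bigr => i _; rewrite scalerDl.
  have [c ->] := (bx (s j) n).1 (u j).
  (* [c] is arbitrary on generators entering after [s j]: they vanish at [s j] but perhaps not at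
     [t], so their coefficients are reset to 0. *)
  exists (fun i => if gent (x i) <= s j then c i else 0).
  rewrite linear_sum [RHS]big_mkcond /=; apply: eq_bigr => i _.
  rewrite linearZ /=; case: (leP (gent (x i)) (s j)) => [le|gt].
    by rewrite (le_lt_trans le (st j)) gimage_trans.
  rewrite gimage_eq0 ?linear0 ?scaler0 ?scale0r ?if_same //.
  by rewrite negb_and -ltNge gt orbT.
(* One summand for each generator entering before [t], taken at its own entrance time. *)
pose A := [set i | gent (x i) < t].
have At (k : 'I_#|A|) : gent (x (enum_val k)) < t.
  by have := enum_valP k; rewrite inE.
exists #|A|, (fun k => gent (x (enum_val k))), At.
exists (fun k => c (enum_val k) *: gimage (x (enum_val k)) _ n).
rewrite (eq_bigl (mem A)) => [|i]; last by rewrite !inE.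
rewrite big_enum_val. apply: eq_bigr => k _.
by rewrite linearZ /= gimage_trans.
Qed.

(** By [in_radicalP] the generators entering before [t] span the radical at [t], so those entering
    exactly at [t] give a basis of the quotient. *)
Lemma pointwise_basis_quasi_minimal : quasi_minimal_generators x.
Proof.
split=> [|t n]; first exact: pointwise_basis_generates.
split=> [c /in_radicalP[a ca] i xn xt|v].
  (* Coefficients of the relation obtained by subtracting the radical expression [a] from the
     combination [c]. *)
  pose b i := if gent (x i) == t then if gdeg (x i) == n then c i else 0
              else if gent (x i) < t then - a i else 0.
  suff: b i = 0 by rewrite /b xt xn !eqxx.
  apply: (bx t n).2; rewrite ?xt //.
  move/eqP: ca; rewrite -subr_eq0 => /eqP ca; rewrite -[RHS]ca.
  rewrite -sumrN [X in _ = X + _]big_mkcond [X in _ = _ + X]big_mkcond.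
  rewrite -big_split /=; apply: eq_bigr => j _; rewrite /b.
  case: (ltgtP (gent (x j)) t); case: eqP;
    by rewrite /= ?(scale0r, scaleNr, add0r, subr0, addr0).
(* The same [c] serves twice: its terms entering before [t] lie in the radical, and the remaining
   ones reduce to those entering at [t] in degree [n]. *)
have [c ->] := (bx t n).1 v; exists c; apply/in_radicalP; exists c.
rewrite [X in X - _](bigID (fun i => gent (x i) < t)) /= -addrA.
rewrite [X in _ + X](_ : _ = 0) ?addr0 //; apply/eqP; rewrite subr_eq0; apply/eqP.
rewrite big_mkcond [RHS]big_mkcond; apply: eq_bigr => i _ /=.
case: (ltgtP (gent (x i)) t) => [|lt|<-]; rewrite /= ?andbT ?andbF //.
  by rewrite gimage_eq0 ?scaler0 // negb_and -ltNge lt orbT.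
by case: eqP => //= /eqP ne; rewrite gimage_eq0 ?scaler0 // negb_and ne.
Qed.

(** An equation established at the least time at which all generators are present can be pushed
    forward to every other such time. *)
Lemma ents_least_upper_bound : exists2 t0, forall i, gent (x i) <= t0 &
  forall t, (forall i, gent (x i) <= t) -> t0 <= t.
Proof.
exists (\big[Order.max/0%:nng]_i gent (x i)) => [i|t xt].
  exact: le_bigmax.
by apply/bigmax_leP; split=> // ; rewrite -num_le /=.
Qed.

Lemma total_boundary_matrix_exists :
  exists d : 'M[F]_m, is_total_boundary_matrix x d.
Proof.
have [t0 xt0 t0min] := ents_least_upper_bound.
(* Finite functions and a boolean equation make the coefficients available to [xchoose]. *)
have span n (v : X t0 n) :
    exists c : {ffun 'I_m -> F}, v == \sum_i c i *: gimage (x i) t0 n.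
  have [c ->] := (bx t0 n).1 v; exists [ffun i => c i].
  by apply/eqP; apply: eq_bigr => i _; rewrite ffunE.
pose c n j := xchoose (span n (diff (X t0) n (gimage (x j) t0 n.+1))).
(* Row [i] is read in the degree of [x i]; in any other degree its term vanishes. *)
exists (\matrix_(i, j) c (gdeg (x i)) j i) => t xt j n.
have t0t := t0min t xt.
rewrite -(gimage_trans t0t n.+1 (xt0 j)) -trans_diff.
have /eqP-> := xchooseP (span n (diff (X t0) n (gimage (x j) t0 n.+1))).
rewrite linear_sum; apply: eq_bigr => i _.
rewrite linearZ /= gimage_trans // mxE -/(c n j).
have [->//|ne] := eqVneq (gdeg (x i)) n.
by rewrite gimage_eq0 ?scaler0 // (negPf ne).
Qed.

Lemma total_boundary_matrix_unique (d d' : 'M[F]_m) :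
  is_total_boundary_matrix x d -> is_total_boundary_matrix x d' -> d = d'.
Proof.
have [t0 xt0 _] := ents_least_upper_bound.
move=> hd hd'; apply/matrixP => i j; apply/eqP; rewrite -subr_eq0; apply/eqP.
apply: ((bx t0 (gdeg (x i))).2 (fun i => d i j - d' i j)) => //.
under eq_bigr do rewrite scalerBl.
by rewrite big_split /= sumrN -hd // -hd' // subrr.
Qed.

End PointwiseBasis.

(** * The simplices as a basis of the chains at every time and degree *)

Section SimplexGenerators.
Variables (F : fieldType) (R : realType) (V : finType).
Variables (K : filteredComplex R V) (o : orientation V).

Lemma sdimE t n (T : simplex_at K t n) (S : simplex K) :
  val T = val S -> sdim S = n /\ sent S <= t.
Proof.
by case/and3P: (valP T) => _ /eqP Tn Tt TS; rewrite /sdim /sent -TS Tn.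
Qed.

Lemma gimage_simplexE (S : simplex K) t n (T : simplex_at K t n) :
  (gimage (simplex_generator F o S) t n : chains_space F K t n) T =
  (val T == val S)%:R.
Proof.
case: (boolP ((sdim S == n) && (sent S <= t))) => [/andP[/eqP e St]|nS].
  (* Substituting the degree equation in the type of [T] puts the goal in the degree of the
     generator, where [gimageE] applies. *)
  case: n / e T => T.
  rewrite [gimage _ _ _](gimageE (g := simplex_generator F o S) St) /=.
  by rewrite free_hom_gen ffunE -val_eqE.
rewrite gimage_eq0 // ffunE; case: eqP => // /sdimE[Sn St].
by rewrite Sn eqxx St in nS.
Qed.

Lemma gimage_simplex (S : simplex K) t n (T : simplex_at K t n) :
  val T = val S -> gimage (simplex_generator F o S) t n = free_gen F T.
Proof.
by move=> TS; apply/ffunP => U; rewrite gimage_simplexE ffunE -TS -val_eqE.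
Qed.

Lemma gimage_simplex_neq0 (S : simplex K) t n :
  gimage (simplex_generator F o S) t n != 0 ->
  exists T : simplex_at K t n, val T = val S.
Proof.
case: (boolP ((sdim S == n) && (sent S <= t))) => [/andP[/eqP <- St] _|nS].
  by exists (SimplexAt (simplex_at_le St (SimplexAt (simplex_at_sent S)))).
by rewrite gimage_eq0 ?eqxx.
Qed.

Variables (m : nat) (sigma : 'I_m -> simplex K).
Hypothesis sigma_bij : bijective sigma.

Lemma simplex_coordE (c : 'I_m -> F) t n (T : simplex_at K t n) i :
  val T = val (sigma i) ->
  (\sum_j c j *: gimage (simplex_generator F o (sigma j)) t n
     : chains_space F K t n) T = c i.
Proof.
move=> Ti; rewrite sum_ffunE (bigD1 i) //= big1 => [|j ji].
  by rewrite ffunE gimage_simplexE Ti eqxx addr0 [_ *: _]mulr1.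
rewrite ffunE gimage_simplexE Ti val_eqE (inj_eq (bij_inj sigma_bij)) eq_sym.
by rewrite (negPf ji) [_ *: _]mulr0.
Qed.

Lemma simplex_pointwise_basis :
  pointwise_basis (fun i => simplex_generator F o (sigma i)).
Proof.
move=> t n; split=> [v|c c0 i xn xt].
  (* This sum has at most one term: the value of [v] at [sigma i], or 0 if [sigma i] is not an
     [n]-simplex present at [t]. *)
  exists (fun i => \sum_(T : simplex_at K t n | val T == val (sigma i))
    (v : chains_space F K t n) T).
  apply/ffunP => T; case: sigma_bij => g gK Kg.
  have TK : val T \in faces K by case/and3P: (valP T).
  rewrite (@simplex_coordE _ _ _ _ (g (exist _ (val T) TK))) ?Kg //=.
  by rewrite (bigD1 T) //= big1 ?addr0 // => U /andP[/eqP/val_inj ->]; rewrite eqxx.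
have Sat : is_simplex_at K t n (val (sigma i)).
  by rewrite -xn; exact: (simplex_at_le xt (SimplexAt (simplex_at_sent _))).
by rewrite -(@simplex_coordE c t n (SimplexAt Sat)) // c0 ffunE.
Qed.

End SimplexGenerators.

(** * The projection [1 - s f] onto the kernel, and the generators of the kernel *)

Section KernelProjection.
Variables (F : fieldType) (R : realType) (V W : finType).
Variables (K : filteredComplex R V) (L : filteredComplex R W).
Variables (oK : orientation V) (oL : orientation W).
Variables (f : simplicialMap K L) (s : simplicialMap L K) (sK : cancel s f).

Let fC := induced F oK oL f.
Let sC := induced F oL oK s.

Definition ker_proj t n : 'End(chains F K oK t n) :=
  (\1 - (sC t n \o fC t n))%VF.

Lemma ker_projE t n z : ker_proj t n z = z - sC t n (fC t n z).
Proof. by rewrite add_lfunE opp_lfunE comp_lfunE id_lfunE. Qed.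

Lemma ker_proj_diff t n z :
  ker_proj t n (diff (chains F K oK t) n z) =
  diff (chains F K oK t) n (ker_proj t n.+1 z).
Proof. by rewrite !ker_projE !chmor_diff linearB. Qed.

Lemma ker_proj_trans t u (tu : t <= u) n z :
  ker_proj u n (trans (chains F K oK) tu n z) =
  trans (chains F K oK) tu n (ker_proj t n z).
Proof. by rewrite !ker_projE !chmor_trans linearB. Qed.

Lemma ker_proj_ker t n (z : filtered_ker fC t n) :
  ker_proj t n (vsval z) = vsval z.
Proof.
have := subvsP z; rewrite memv_ker ker_projE => /eqP ->.
by rewrite linear0 subr0.
Qed.

(** A nonzero coefficient at [T] in the image of an oriented simplex [U] forces [T] to have vertex
    set [s @: U]. *)
Lemma section_coord t n y (T : simplex_at K t n) :
  (forall U : simplex L, s @: val U != val T) ->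
  (sC t n y : chains_space F K t n) T = 0.
Proof.
move=> nT; rewrite /sC /= /induced_hom free_homE sum_ffunE big1 // => U _.
rewrite ffunE ffunE [X in _ *: X](_ : _ = 0) ?scaler0 //.
apply/eqP/negPn/negP => /rel_sign_neq0 UT.
have UL : val U \in faces L by case/and3P: (valP U).
have /eqP[] := nT (exist _ (val U) UL).
rewrite /= -(orient_set oL U) -(map_set s) -(orient_set oK T).
by apply/setP => v; rewrite !inE UT.
Qed.

Lemma ker_proj_coord t n z (T : simplex_at K t n) :
  (forall U : simplex L, s @: val U != val T) ->
  (ker_proj t n z : chains_space F K t n) T = (z : chains_space F K t n) T.
Proof. by move=> nT; rewrite ker_projE !ffunE section_coord // subr0. Qed.

(** Each vertex of [T] is in the image of [s], hence fixed by [s f]; the ordered vertex tuple is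
    thus unchanged and no sign appears. *)
Lemma ker_proj_free_gen0 t n (T : simplex_at K t n) (U : {set W}) :
  s @: U = val T -> ker_proj t n (free_gen F T) = 0.
Proof.
move=> sU; have [TK Tt] := orient_face oK T.
have [fK ft] := map_orient_face f TK Tt.
rewrite ker_projE -(oriented_chain_orient F oK) /= !induced_oriented //.
apply/eqP; rewrite subr_eq0; apply/eqP; congr oriented_chain.
apply: eq_from_tnth => i; rewrite !tnth_map.
have : tnth (orient_tuple oK T) i \in s @: U.
  by rewrite sU -(orient_set oK T) inE mem_tnth.
by case/imsetP => w _ ->; rewrite sK.
Qed.

Lemma ker_proj_in_image (S : simplex K) t n : in_image s S ->
  ker_proj t n (gimage (simplex_generator F oK S) t n) = 0.
Proof.
case/existsP => U /eqP sU.
have [->|/gimage_simplex_neq0[T TS]] :=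
  eqVneq (gimage (simplex_generator F oK S) t n) 0; first exact: linear0.
by rewrite (gimage_simplex _ _ TS) (ker_proj_free_gen0 (U := val U)) ?sU.
Qed.

(** Links the algebraic condition for removal to the combinatorial one: outside the image of [s],
    the projection keeps the coefficient 1 at [S] and so cannot vanish. *)
Lemma simplex_chain_retract (S : simplex K) :
  (simplex_chain F oK S == retract_chain F oK oL f s S) = in_image s S.
Proof.
rewrite -subr_eq0 -[X in X == 0]ker_projE.
apply/idP/idP => [|/existsP[U /eqP sU]]; last first.
  by rewrite (ker_proj_free_gen0 (U := val U)) ?sU.
apply: contraTT => /existsPn nS; apply/negP => /eqP P0.
have := ker_proj_coord (simplex_chain F oK S) (T := SimplexAt (simplex_at_sent S)) nS.
by rewrite P0 !ffunE eqxx => /eqP; rewrite eq_sym oner_eq0.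
Qed.

Lemma gimage_kernel (S : simplex K) t n :
  vsval (gimage (kernel_generator F oK oL sK S) t n) =
  ker_proj t n (gimage (simplex_generator F oK S) t n).
Proof.
case: (boolP ((sdim S == n) && (sent S <= t))) => [/andP[/eqP <- St]|nS].
  rewrite (gimageE (g := kernel_generator F oK oL sK S) St).
  rewrite (gimageE (g := simplex_generator F oK S) St).
  by rewrite ker_proj_trans [LHS]ker_transE ker_projE.
rewrite (gimage_eq0 (g := kernel_generator F oK oL sK S) nS).
by rewrite (gimage_eq0 (g := simplex_generator F oK S) nS) !linear0.
Qed.

Variables (m : nat) (sigma : 'I_m -> simplex K).
Hypothesis sigma_bij : bijective sigma.

Let x i := simplex_generator F oK (sigma i).
Let kept := [set i : 'I_m | ~~ in_image s (sigma i)].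
Let y (i : 'I_#|kept|) := kernel_generator F oK oL sK (sigma (enum_val i)).

(** The projection kills the terms in the image of [s] and turns each kept simplex into its kernel
    generator. *)
Lemma ker_proj_sum (c : 'I_m -> F) t n :
  ker_proj t n (\sum_i c i *: gimage (x i) t n) =
  vsval (\sum_i c (enum_val i) *: gimage (y i) t n).
Proof.
rewrite !linear_sum (bigID (mem kept)) /= addrC big1 ?add0r => [|i ik].
  rewrite big_enum_val; apply: eq_bigr => i _.
  by rewrite !linearZ /= gimage_kernel.
rewrite linearZ /= ker_proj_in_image ?scaler0 //.
by rewrite inE negbK in ik.
Qed.

Lemma kernel_pointwise_basis : pointwise_basis y.
Proof.
move=> t n; split=> [v|c c0 i yn yt].
  have [c vc] := (simplex_pointwise_basis F oK sigma_bij t n).1 (vsval v).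
  exists (fun i => c (enum_val i)); apply: val_inj.
  by apply: etrans (ker_proj_sum c t n); rewrite -vc ker_proj_ker.
(* [c] extended by 0 to all simplices, so that the relation among kernel generators becomes the
   projection of a chain of [K]. *)
pose b j := if [pick k | enum_val k == j] is Some k then c k else 0.
have bE k : b (enum_val k) = c k.
  rewrite /b; case: pickP => [l /eqP/enum_val_inj -> //|/(_ k)].
  by rewrite eqxx.
have Sat : is_simplex_at K t n (val (sigma (enum_val i))).
  by rewrite -yn; exact: (simplex_at_le yt (SimplexAt (simplex_at_sent _))).
have nS (U : simplex L) : s @: val U != val (SimplexAt Sat).
  by have := enum_valP i; rewrite inE => /existsPn.
(* [c i] is the coordinate of that chain at a simplex outside the image of [s], which the projection
   preserves; the projected chain is 0. *)
rewrite -bE -(simplex_coordE oK sigma_bij b (T := SimplexAt Sat)) //.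
rewrite -(ker_proj_coord _ nS) ker_proj_sum.
by under eq_bigr do rewrite bE; rewrite c0 ffunE.
Qed.

Lemma kernel_total_boundary_matrix (d : 'M[F]_m) :
  is_total_boundary_matrix x d ->
  is_total_boundary_matrix y (mxsub enum_val enum_val d).
Proof.
move=> hd t yt j n; have [t0 xt0 _] := ents_least_upper_bound x.
(* A time t at which all the y i have entered may precede the entrance of some
   x i outside kept, so the equation is checked at a later time u. *)
pose u := Order.max t t0.
have tu : t <= u by rewrite le_max lexx.
apply: (@filtered_mono _ _ (filtered_ker fC) _ _ tu).
rewrite trans_diff (gimage_trans (g := y j)) //.
transitivity (\sum_i d (enum_val i) (enum_val j) *: gimage (y i) u n); last first.
  rewrite linear_sum; apply: eq_bigr => i _; rewrite linearZ mxE /=.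
  by congr (_ *: _); apply/esym/(gimage_trans (g := y i) tu n (yt i)).
(* The right-hand side is the projection of column [enum_val j] of [d], that is, of the boundary of
   that simplex at [u]. *)
apply: val_inj; apply: etrans (ker_proj_sum (d^~ (enum_val j)) u n).
rewrite -hd => [|i]; last by rewrite le_max xt0 orbT.
by rewrite ker_proj_diff [LHS]ker_diffE gimage_kernel.
Qed.

End KernelProjection.

(** * The boundary matrix of the kernel as a submatrix *)

Theorem mainTheorem4 (R : realType) (p : nat) (p_prime : prime p)
    (V W : finType) (K : filteredComplex R V) (L : filteredComplex R W)
    (oK : orientation V) (oL : orientation W)
    (f : simplicialMap K L) (s : simplicialMap L K) (sK : cancel s f)
    (m : nat) (sigma : 'I_m -> simplex K) (sigma_bij : bijective sigma) :
  let x := fun i : 'I_m => simplex_generator 'F_p oK (sigma i) in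
  let kept := [set i : 'I_m | ~~ in_image s (sigma i)] in
  let y := fun i : 'I_#|kept| =>
    kernel_generator 'F_p oK oL sK (sigma (enum_val i)) in
  let removed := [set i : 'I_m |
    simplex_chain 'F_p oK (sigma i) == retract_chain 'F_p oK oL f s (sigma i)] in
  quasi_minimal_generators y /\
  kept = ~: removed /\
  exists d : 'M['F_p]_m,
    unique (is_total_boundary_matrix x) d /\
    unique (is_total_boundary_matrix y) (mxsub enum_val enum_val d).
Proof.
move=> x kept y removed.
have bx : pointwise_basis x := simplex_pointwise_basis _ oK sigma_bij.
have bY : pointwise_basis y := kernel_pointwise_basis _ oK oL sK sigma_bij.
split; first exact: pointwise_basis_quasi_minimal.
split; first by apply/setP => i; rewrite !inE simplex_chain_retract.
have [d hd] := total_boundary_matrix_exists bx.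
have hy : is_total_boundary_matrix y (mxsub enum_val enum_val d) :=
  kernel_total_boundary_matrix hd.
exists d; split; split=> // d'; exact: total_boundary_matrix_unique.
Qed.
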